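(* Let $2 \leqslant d \leqslant n-1$. Among trees on $n$ vertices and diameter $d$, the caterpillar $C_{n,d}$ has minimal Laplacian coefficient $c_k$ for every $k = 0, 1, \ldots, n$; that is, $c_k(C_{n,d}) \leqslant c_k(T)$ for every tree $T$ on $n$ vertices with diameter $d$ and every $k = 0, 1, \ldots, n$.
   Context: For a simple graph $G$ on $n$ vertices with Laplacian matrix $L(G) = D(G) - A(G)$, the Laplacian coefficients $c_0(G), \ldots, c_n(G)$ are defined by $\det(\lambda I_n - L(G)) = \sum_{k=0}^n (-1)^k c_k(G) \lambda^{n-k}$. $C(a_1, \ldots, a_{d-1})$ is the caterpillar obtained from a path with vertices $v_0, v_1, \ldots, v_d$ (in this order) by attaching $a_i$ pendent edges to the vertex $v_i$, $i = 1, \ldots, d-1$; it has $n = d + 1 + \sum_{i=1}^{d-1} a_i$ vertices. $C_{n,d} = C(0, \ldots, 0, a_{\lfloor d/2 \rfloor}, 0, \ldots, 0)$ with $a_{\lfloor d/2 \rfloor} = n - d - 1$, i.e. all $n-d-1$ pendent edges are attached at $v_{\lfloor d/2 \rfloor}$. *)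

(* Defs.v *)
From mathcomp Require Import all_boot all_order all_algebra.

Set Implicit Arguments.
Unset Strict Implicit.
Unset Printing Implicit Defensive.

Import Order.TTheory GRing.Theory Num.Theory.

Local Open Scope ring_scope.

Record sgraph (V : finType) := SGraph {
  adj :> rel V;
  adj_sym : symmetric adj;
  adj_irr : irreflexive adj
}.

Section Graphs.
Variables (V : finType) (G : sgraph V).

Definition degree (v : V) : nat := #|[set w | G v w]|.

(* Rows and columns are numbered through enum_val : 'I_#|V| -> V. *)
Definition degree_mx : 'M[int]_#|V| :=
  diag_mx (\row_i (degree (enum_val i))%:R).

Definition adjacency_mx : 'M[int]_#|V| :=
  \matrix_(i, j) (G (enum_val i) (enum_val j))%:R.

Definition laplacian : 'M[int]_#|V| := degree_mx - adjacency_mx.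

(* Meaningful for k <= #|V| only; see char_poly_laplacian. *)
Definition lap_coef (k : nat) : int :=
  (-1) ^+ k * (char_poly laplacian)`_(#|V| - k).

Lemma char_poly_laplacian :
  \det ('X%:M - map_mx polyC laplacian)
    = \sum_(k < #|V|.+1) ((-1) ^+ k * lap_coef k) *: 'X^(#|V| - k).
Proof.
rewrite -/(char_poly laplacian).
set p := char_poly _.
have sz : (size p <= #|V|.+1)%N by rewrite size_char_poly.
rewrite (reindex_inj rev_ord_inj) /=.
rewrite -[LHS](coefK p) (poly_def (size p)).
rewrite (big_ord_widen_cond _ xpredT (fun i => p`_i *: 'X^i) sz).
rewrite big_mkcond /=; apply: eq_bigr => i _.
have hi : (i <= #|V|)%N by rewrite -ltnS.
rewrite /lap_coef subSS subKn // mulrA -exprMn mulrNN mulr1 expr1n mul1r.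
by case: ltnP => // h; rewrite -/p nth_default // scale0r.
Qed.

Definition connected_graph : Prop := forall u v : V, connect G u v.

Definition acyclic_graph : Prop :=
  forall c : seq V, (2 < size c)%N -> ~ ucycle G c.

Definition is_tree : Prop := connected_graph /\ acyclic_graph.

Definition has_walk (u v : V) (l : nat) : bool :=
  [exists p : l.-tuple V, path G u p && (last u p == v)].

(* The least length of a walk from u to v, or #|V| if there is none: a
   shortest walk is a path, so its length is less than #|V|. *)
Definition gdist (u v : V) : nat := find (has_walk u v) (iota 0 #|V|).

Definition diameter : nat := (\max_(u : V) \max_(v : V) gdist u v)%N.

Lemma gdist_min (u v : V) (p : seq V) :
  path G u p -> last u p = v -> (gdist u v <= size p)%N.
Proof.
move=> pp pl; have [le_p|lt_p] := leqP #|V| (size p).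
  by apply: leq_trans le_p; have := find_size (has_walk u v) (iota 0 #|V|); rewrite size_iota.
rewrite leqNgt; apply/negP => /(before_find 0%N).
rewrite nth_iota // add0n => /negbT/negP; apply.
by apply/existsP; exists (in_tuple p); rewrite pp pl eqxx.
Qed.

Lemma gdist_attained (u v : V) : connect G u v ->
  exists p : seq V, [/\ path G u p, last u p = v & size p = gdist u v].
Proof.
case/connectP => p0 /shortenP[p pp up _] pl.
have szp : (size p < #|V|)%N by have := card_uniqP up => /= <-; apply: max_card.
have hw : has (has_walk u v) (iota 0 #|V|).
  apply/hasP; exists (size p); first by rewrite mem_iota.
  by apply/existsP; exists (in_tuple p); rewrite pp pl eqxx.
have := nth_find 0%N hw; rewrite nth_iota; last first.
  by move: hw; rewrite has_find size_iota.
rewrite add0n => /existsP[q /andP[qp /eqP ql]].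
by exists q; split=> //; rewrite size_tuple.
Qed.

End Graphs.

Section Caterpillars.
Variables (d : nat) (a : nat -> nat).

(* inl i is the path vertex v_i (0 <= i <= d); inr (Tagged _ j), with tag
   i : 'I_d.-1, is the j-th leaf attached at v_(i+1).  So only the values
   a 1, ..., a d.-1 are used. *)
Definition cat_vertex : finType :=
  ('I_d.+1 + {i : 'I_d.-1 & 'I_(a i.+1)})%type.

Definition cat_adj (x y : cat_vertex) : bool :=
  match x, y with
  | inl i, inl j => (i.+1 == j :> nat) || (j.+1 == i :> nat)
  | inl i, inr p => i == (tag p).+1 :> nat
  | inr p, inl i => i == (tag p).+1 :> nat
  | inr _, inr _ => false
  end.

Lemma cat_adj_sym : symmetric cat_adj.
Proof. by move=> [i|p] [j|q] //=; rewrite orbC. Qed.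

Lemma cat_adj_irr : irreflexive cat_adj.
Proof. by case=> [i|p] //=; rewrite orbb gtn_eqF. Qed.

Definition caterpillar : sgraph cat_vertex := SGraph cat_adj_sym cat_adj_irr.

Lemma card_cat_vertex :
  #|cat_vertex| = (d + 1 + \sum_(1 <= i < d) a i)%N.
Proof.
rewrite card_sum card_ord card_tagged sumnE big_map big_enum /= addn1.
congr (_ + _)%N; rewrite big_add1 big_mkord.
by apply: eq_bigr => i _; rewrite card_ord.
Qed.

End Caterpillars.

Definition Cnd_seq (n d i : nat) : nat := if i == d./2 then (n - d - 1)%N else 0%N.

Definition Cnd (n d : nat) : sgraph (cat_vertex d (Cnd_seq n d)) :=
  caterpillar d (Cnd_seq n d).

Lemma card_Cnd (n d : nat) : (2 <= d <= n - 1)%N ->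
  #|cat_vertex d (Cnd_seq n d)| = n.
Proof.
case/andP=> d2 dn; rewrite card_cat_vertex.
have h1 : (0 < d./2)%N by rewrite half_gt0.
have h2 : (d./2 < d)%N.
  by rewrite ltn_half_double -addnn -[X in (X < _)%N]addn0 ltn_add2l (ltnW d2).
rewrite (bigD1_seq d./2) ?iota_uniq ?mem_index_iota ?h1 //= {1}/Cnd_seq eqxx.
rewrite big1 => [|i /negbTE ne]; last by rewrite /Cnd_seq ne.
have dn1 : (d + 1 <= n)%N.
  by case: (n) dn => [|m]; [move/(leq_trans d2) | rewrite subn1 addn1].
by rewrite addn0 -subnDA subnKC.
Qed.

(* Main.v *)
Require Import Defs.
From mathcomp Require Import all_boot all_order all_algebra.
From mathcomp Require Import perm ring zify.

Set Implicit Arguments.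
Unset Strict Implicit.
Unset Printing Implicit Defensive.

Import Order.TTheory GRing.Theory Num.Theory.

Local Open Scope ring_scope.

(** Let L be the Laplacian of a tree on n vertices. The coefficient of
    X^(n - k) in det(X + L) is c_k, so the theorem compares two such
    polynomials coefficient by coefficient.

    Build the tree by adding leaves one at a time, and for a set t of vertices
    let D_t be the 0/1 diagonal matrix of t. Put P_t = det(X + D_t L D_t); the
    vertices outside t are said to be grounded. (The coefficient of X^(n - j)
    in P_t counts the j-matchings of the subdivided tree from which the
    grounded vertices are deleted.) If l is a new leaf hung at w, then X + L
    changes by a rank-one matrix, which gives, for the tree T' before the leaf
    was added,

      P_t(T) = (X + [l in t]) P_t(T') + [w in t] P_(t - w)(T').

    This recursion has nonnegative coefficients, hence P_t has too and is
    monotone in t (le_grounded_poly).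

    Grow the tree T from a diametral path v_0 ... v_d by adding the other
    s = n - d - 1 vertices one at a time, and compare with the broom C_{n,d},
    whose s extra leaves all hang at the centre m = d/2. With nothing grounded,
    each new leaf contributes (X + 1) P(T') + P_(all but w)(T'), so by
    induction it is enough that grounding one vertex w in any tree containing
    the path and s other vertices leaves at least what grounding the centre
    leaves in the broom. The latter is exactly (X + 1)^s times the value for
    the bare path grounded at its centre (grounded_broom_center), and the same
    recursion bounds the former below by (X + 1)^s times the value for the bare
    path grounded at some vertex v_u (le_grounded_vertex). Grounding v_u cuts
    the path in two, giving X q_u q_(d - u), where q_j comes from a path with
    2j vertices. The identity
    q_a q_(a+c+1) = q_(a+1) q_(a+c) + h_c (path_matching_exchange), with h_c
    nonnegative, says that this product decreases as u moves towards the
    centre.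

    What remains is bookkeeping. The recursion is the determinant of the matrix
    X + D_t L D_t (det_grounded); a tree can be enumerated starting with a
    diametral path and attaching each later vertex to exactly one earlier
    vertex (grown_path, grown_extend), exactly one because a second neighbour
    would close a cycle; and the vertices of C_{n,d} are enumerated directly
    (codes_Cnd). *)

(** * Coefficientwise order on integer polynomials *)

Definition coef_ge0 (p : {poly int}) : Prop := forall i, 0 <= p`_i.

Lemma coef_ge0_nat (m : nat) : coef_ge0 m%:R.
Proof. by move=> i; rewrite -polyC_natr coefC; case: (i == 0%N). Qed.

Lemma coef_ge0X : coef_ge0 'X.
Proof. by move=> i; rewrite coefX; case: (i == 1%N). Qed.

Lemma coef_ge0D p q : coef_ge0 p -> coef_ge0 q -> coef_ge0 (p + q).
Proof. by move=> p0 q0 i; rewrite coefD addr_ge0. Qed.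

Lemma coef_ge0M p q : coef_ge0 p -> coef_ge0 q -> coef_ge0 (p * q).
Proof. by move=> p0 q0 i; rewrite coefM sumr_ge0 // => j _; rewrite mulr_ge0. Qed.

Lemma coef_ge0XDn (m : nat) : coef_ge0 ('X + m%:R).
Proof. exact: coef_ge0D coef_ge0X (coef_ge0_nat m). Qed.

Definition le_coef (p q : {poly int}) : Prop := coef_ge0 (q - p).

Local Notation "p <=c q" := (le_coef p q) (at level 70, no associativity).

Lemma le_coefP (p q : {poly int}) (i : nat) : p <=c q -> p`_i <= q`_i.
Proof. by move=> /(_ i); rewrite coefB subr_ge0. Qed.

Lemma le_coef_refl p : p <=c p.
Proof. by rewrite /le_coef subrr; exact: (coef_ge0_nat 0). Qed.

Lemma le_coef_trans q p r : p <=c q -> q <=c r -> p <=c r.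
Proof.
by move=> pq qr; rewrite /le_coef -[r](subrK q) -addrA; apply: coef_ge0D.
Qed.

Lemma le_coefD p q r s : p <=c q -> r <=c s -> p + r <=c q + s.
Proof.
by move=> pq rs; rewrite /le_coef opprD addrACA; apply: coef_ge0D.
Qed.

Lemma le_coefMl p q r : coef_ge0 p -> q <=c r -> p * q <=c p * r.
Proof. by move=> p0 qr; rewrite /le_coef -mulrBr; apply: coef_ge0M. Qed.

Lemma le_coefM p q r s : coef_ge0 p -> coef_ge0 s ->
  p <=c q -> r <=c s -> p * r <=c q * s.
Proof.
move=> p0 s0 pq rs; apply: (@le_coef_trans (p * s)); first exact: le_coefMl.
by rewrite mulrC [q * s]mulrC; apply: le_coefMl.
Qed.

Lemma le_coef_addr p q : coef_ge0 q -> p <=c p + q.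
Proof. by rewrite /le_coef addrC addKr. Qed.

(** * Trees coded by parent lists *)

(** A tree with vertices 0, ..., size p is coded by the list p of the parents of
    its non-root vertices, latest vertex first: in w :: p' the vertex
    (size p').+1 is a leaf hung at w. A predicate t on vertices marks the ones
    that are not grounded. *)
Definition ground (w : nat) (t : nat -> bool) : nat -> bool :=
  fun i => t i && (i != w).

(** This is det(X + D_t L D_t), by det_grounded; defining it by the leaf
    recursion makes the sign of its coefficients evident. *)
Fixpoint grounded_poly (p : seq nat) (t : nat -> bool) : {poly int} :=
  if p is w :: p' then
    ('X + (t (size p))%:R) * grounded_poly p' t
      + (t w)%:R * grounded_poly p' (ground w t)
  else 'X.

Fixpoint valid_parents (p : seq nat) : bool :=
  if p is w :: p' then (w <= size p')%N && valid_parents p' else true.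

Lemma grounded_poly_cons w p t :
  grounded_poly (w :: p) t = ('X + (t (size p).+1)%:R) * grounded_poly p t
      + (t w)%:R * grounded_poly p (ground w t).
Proof. by []. Qed.

Lemma eq_grounded_poly p t t' : valid_parents p ->
  (forall i, (i <= size p)%N -> t i = t' i) ->
  grounded_poly p t = grounded_poly p t'.
Proof.
elim: p t t' => [|w p IHp] t t' //= /andP[w_le vp] tt'.
rewrite (tt' _ (leqnn _)) (tt' w) ?(leq_trans w_le) //.
congr (_ * _ + _ * _); apply: IHp => // i i_le; rewrite ?/ground tt' //.
  exact: leqW.
exact: leqW.
Qed.

Lemma grounded_poly_ge0 p t : coef_ge0 (grounded_poly p t).
Proof.
elim: p t => [|w p IHp] t /=; first exact: coef_ge0X.
by apply: coef_ge0D; apply: coef_ge0M => //;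
  [exact: coef_ge0XDn | exact: coef_ge0_nat].
Qed.

(** Every term of the recursion is a product of nonnegative factors that
    increase with t. *)
Lemma le_grounded_poly p (t t' : nat -> bool) : (forall i, t' i -> t i) ->
  grounded_poly p t' <=c grounded_poly p t.
Proof.
have le_b (b b' : bool) : (b -> b') -> (b%:R : {poly int}) <=c b'%:R.
  case: b b' => [] [] h; try exact: le_coef_refl; first by have := h isT.
  by rewrite /le_coef subr0; exact: coef_ge0_nat.
elim: p t t' => [|w p IHp] t t' sub; first exact: le_coef_refl.
rewrite !grounded_poly_cons; apply: le_coefD; apply: le_coefM;
  try solve [exact: coef_ge0_nat | exact: coef_ge0XDn | exact: grounded_poly_ge0
            | exact: IHp].
- by apply: le_coefD; [exact: le_coef_refl | exact: le_b (sub _)].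
- exact: le_b (sub _).
- by apply: IHp => i /andP[ti iw]; rewrite /ground sub.
Qed.

(** * Paths with a grounded vertex *)

Definition path_parents (d : nat) : seq nat := rev (iota 0 d).

Lemma path_parentsS d : path_parents d.+1 = d :: path_parents d.
Proof. by rewrite /path_parents -addn1 iotaD rev_cat. Qed.

Lemma size_path_parents d : size (path_parents d) = d.
Proof. by rewrite size_rev size_iota. Qed.

Lemma valid_path_parents d : valid_parents (path_parents d).
Proof.
by elim: d => [|d IHd] //; rewrite path_parentsS /= size_path_parents leqnn.
Qed.

Local Notation all_true := (fun _ : nat => true).

(** The matching polynomials, with coefficient of X^(j - i) counting i-matchings,
    of the path with 2j vertices (first component q_j) and of the path with
    2j - 1 vertices (second component h_j, with h_0 = 0). The subdivision of a path on j + 1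
    vertices is a path on 2j + 1 vertices. *)
Fixpoint path_matching (j : nat) : {poly int} * {poly int} :=
  if j is j'.+1 then
    let: (q, h) := path_matching j' in (q + ('X * q + h), 'X * q + h)
  else (1, 0).

Local Notation q_ j := (path_matching j).1.
Local Notation h_ j := (path_matching j).2.

Lemma path_matchingS1 j : q_ j.+1 = q_ j + h_ j.+1.
Proof. by rewrite /=; case: (path_matching j). Qed.

Lemma path_matchingS2 j : h_ j.+1 = 'X * q_ j + h_ j.
Proof. by rewrite /=; case: (path_matching j). Qed.

Lemma path_matching_ge0 j :
  coef_ge0 (q_ j) /\ coef_ge0 (h_ j).
Proof.
elim: j => [|j [q0 h0]].
  by split; [exact: (coef_ge0_nat 1) | exact: (coef_ge0_nat 0)].
have h1 : coef_ge0 (h_ j.+1).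
  by rewrite path_matchingS2; apply: coef_ge0D => //; exact: coef_ge0M coef_ge0X q0.
by split=> //; rewrite path_matchingS1; exact: coef_ge0D.
Qed.

(** Grounding an end of a path leaves a factor X and a path with 2j vertices in
    the subdivision. *)
Lemma grounded_path j :
  grounded_poly (path_parents j) all_true = h_ j.+1 /\
  grounded_poly (path_parents j) (ground j all_true) = 'X * q_ j.
Proof.
elim: j => [|j [IHg IHk]]; first by rewrite /= addr0 !mulr1.
rewrite path_parentsS !grounded_poly_cons size_path_parents IHg IHk.
rewrite !(@eq_grounded_poly _ (ground j.+1 _) all_true) ?valid_path_parents //;
  last by move=> i; rewrite size_path_parents /ground; lia.
rewrite (@eq_grounded_poly _ (ground j (ground j.+1 _)) (ground j all_true))
  ?valid_path_parents //;
  last by move=> i; rewrite size_path_parents /ground; lia.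
rewrite IHg IHk /ground /= eqxx ltn_eqF //= !mul1r addr0.
by rewrite (path_matchingS2 j.+1) path_matchingS1; split; ring.
Qed.

(** Deleting an inner vertex u of a path disconnects its subdivision, hence the
    product. *)
Lemma grounded_path_vertex u j :
  grounded_poly (path_parents (u + j)) (ground u all_true) = 'X * q_ u * q_ j.
Proof.
(* The recursion for j + 1 also needs the path grounded at both u and its last
   vertex u + j; for j = 0 these coincide and that term is absent. *)
suff: grounded_poly (path_parents (u + j)) (ground u all_true) = 'X * q_ u * q_ j
  /\ (u != u + j)%N%:R
       * grounded_poly (path_parents (u + j)) (ground (u + j) (ground u all_true))
     = 'X * q_ u * h_ j by case.
elim: j => [|j [IHa IHb]].
  by rewrite addn0 eqxx mul0r mulr0 mulr1 (proj2 (grounded_path u)).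
rewrite addnS path_parentsS !grounded_poly_cons size_path_parents IHa.
rewrite (@eq_grounded_poly _ (ground (u + j).+1 _) (ground u all_true))
  ?valid_path_parents //;
  last by move=> i; rewrite size_path_parents /ground; lia.
rewrite (@eq_grounded_poly _ (ground (u + j) (ground (u+j).+1 _))
    (ground (u + j) (ground u all_true))) ?valid_path_parents //;
  last by move=> i; rewrite size_path_parents /ground; lia.
have -> : ground u all_true (u + j)%N = (u != u + j)%N by rewrite /ground eq_sym.
have -> : ground (u + j).+1 (ground u all_true) (u + j)%N = (u != u + j)%N.
  by rewrite /ground; lia.
have -> : ground u all_true (u + j).+1 by rewrite /ground; lia.
have -> : ground (u + j).+1 (ground u all_true) (u + j).+1 = false by rewrite /ground; lia.
have -> : u != (u + j).+1 by lia.
by rewrite IHa IHb path_matchingS1 path_matchingS2 /= addr0 mul1r; split; ring.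
Qed.

(** Both q_a and q_(a + c) satisfy the recurrence r_(j+2) = (X + 2) r_(j+1) - r_j,
    whose Casoratian is constant: the difference of the two products does not
    depend on a, and it is h_c for a = 0. *)
Lemma path_matching_exchange a c :
  q_ a * q_ (a + c).+1 = q_ a.+1 * q_ (a + c) + h_ c.
Proof.
elim: a => [|a IHa].
  by rewrite add0n !path_matchingS1 !path_matchingS2 /=; ring.
have rec j : q_ j.+2 = ('X + 2%:R) * q_ j.+1 - q_ j.
  by rewrite !(path_matchingS1, path_matchingS2); ring.
have -> : h_ c = q_ a * q_ (a + c).+1 - q_ a.+1 * q_ (a + c) by rewrite IHa; ring.
by rewrite addSn !rec; ring.
Qed.

Lemma le_path_matching_step a b : (a <= b)%N -> q_ a.+1 * q_ b <=c q_ a * q_ b.+1.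
Proof.
move=> /subnKC <-; rewrite path_matching_exchange.
exact/le_coef_addr/(proj2 (path_matching_ge0 _)).
Qed.

(** The product q_u q_(d - u) is symmetric in u and decreases up to the middle. *)
Lemma le_path_matching_center d u : (u <= d)%N ->
  q_ d./2 * q_ (d - d./2) <=c q_ u * q_ (d - u).
Proof.
move=> u_le; wlog le2u : u u_le / (u <= d./2)%N.
  move=> wl; have [/wl|lt2u] := leqP u d./2; first exact.
  rewrite [q_ u * _]mulrC -{2}(subKn u_le); apply: wl; lia.
suff main m : (m <= d./2)%N -> (u <= m)%N -> q_ m * q_ (d - m) <=c q_ u * q_ (d - u).
  exact: main (leqnn _) le2u.
elim: m => [|m IHm] m_le; first by rewrite leqn0 => /eqP ->; exact: le_coef_refl.
rewrite leq_eqVlt => /predU1P[-> | u_lt]; first exact: le_coef_refl.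
apply: le_coef_trans (IHm (ltnW m_le) u_lt).
have -> : (d - m = (d - m.+1).+1)%N by lia.
by apply: le_path_matching_step; lia.
Qed.

(** * Brooms are minimal among trees containing a given path *)

(** Peel off the vertices outside the path. A leaf other than u contributes a
    factor at least X + 1. If u itself is the leaf, hung at w, the recursion
    gives X P + P_w with P >= P_w, so that w takes over the role of u with the
    same factor X + 1. Once only the path is left, its centre gives the smallest
    value. *)
Lemma le_grounded_vertex d q u : valid_parents (q ++ path_parents d) ->
  (u <= size q + d)%N ->
  ('X + 1) ^+ size q * grounded_poly (path_parents d) (ground d./2 all_true)
    <=c grounded_poly (q ++ path_parents d) (ground u all_true).
Proof.
elim: q u => [|w q IHq] u.
  move=> _ u_le; rewrite /= expr0 mul1r.
  have half_le : (d./2 <= d)%N by lia.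
  have -> : grounded_poly (path_parents d) (ground d./2 all_true)
      = 'X * (q_ d./2 * q_ (d - d./2)).
    by rewrite mulrA -grounded_path_vertex subnKC.
  have -> : grounded_poly (path_parents d) (ground u all_true)
      = 'X * (q_ u * q_ (d - u)).
    by rewrite mulrA -grounded_path_vertex subnKC.
  by apply: le_coefMl; [exact: coef_ge0X | exact: le_path_matching_center].
rewrite cat_cons [size _]/= exprS -mulrA => vp u_le.
set p := q ++ _ in vp *; have sz_p : size p = (size q + d)%N.
  by rewrite size_cat size_path_parents.
have /andP[w_le vp'] : (w <= size p)%N && valid_parents p by [].
rewrite grounded_poly_cons.
have [u_eq|u_ne] := eqVneq u (size p).+1; last first.
  have -> : ground u all_true (size p).+1 by rewrite /ground eq_sym.
  apply: le_coef_trans (le_coef_addr _ _); last first.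
    by apply: coef_ge0M; [exact: coef_ge0_nat | exact: grounded_poly_ge0].
  by apply: le_coefMl; [exact: (coef_ge0XDn 1) | apply: IHq => //; lia].
have -> : ground u all_true (size p).+1 = false by rewrite /ground u_eq eqxx.
have -> : ground u all_true w by rewrite /ground; lia.
rewrite (@eq_grounded_poly p (ground w (ground u _)) (ground w all_true)) //;
  last by move=> i; rewrite /ground u_eq; lia.
apply: (@le_coef_trans (('X + 1) * grounded_poly p (ground w all_true))).
  by apply: le_coefMl; [exact: (coef_ge0XDn 1) | apply: IHq => //; lia].
rewrite mulrDl addr0 !mul1r; apply: le_coefD; last exact: le_coef_refl.
apply: le_coefMl; first exact: coef_ge0X.
by rewrite (@eq_grounded_poly p (ground u _) all_true) //;
  [exact: le_grounded_poly | move=> i; rewrite /ground u_eq; lia].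
Qed.

(** With the centre grounded, a leaf hung there interacts with nothing. *)
Lemma grounded_broom_center d s :
  grounded_poly (nseq s d./2 ++ path_parents d) (ground d./2 all_true)
    = ('X + 1) ^+ s * grounded_poly (path_parents d) (ground d./2 all_true).
Proof.
elim: s => [|s IHs]; first by rewrite expr0 mul1r.
rewrite cat_cons grounded_poly_cons IHs size_cat size_nseq size_path_parents.
have -> : ground d./2 all_true (s + d).+1 by rewrite /ground; lia.
by rewrite /ground eqxx mul0r addr0 exprS mulrA.
Qed.

Lemma le_grounded_broom d q : valid_parents (q ++ path_parents d) ->
  grounded_poly (nseq (size q) d./2 ++ path_parents d) all_true
    <=c grounded_poly (q ++ path_parents d) all_true.
Proof.
elim: q => [|w q IHq]; first by move=> _; exact: le_coef_refl.
have -> : nseq (size (w :: q)) d./2 ++ path_parents d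
  = d./2 :: (nseq (size q) d./2 ++ path_parents d) by [].
rewrite cat_cons => vp; have /andP[w_le vp'] := vp.
rewrite !grounded_poly_cons !mul1r grounded_broom_center.
apply: le_coefD; first by apply: le_coefMl; [exact: (coef_ge0XDn 1) | exact: IHq].
by apply: le_grounded_vertex => //; rewrite -(size_path_parents d) -size_cat.
Qed.

(** * The determinant of a grounded tree *)

Lemma det_add_delta (R : comNzRingType) n (M : 'M[R]_n) (w : 'I_n) (c : R) :
  \det (M + c *: delta_mx w w) = \det M + c * cofactor M w w.
Proof.
have cof j : cofactor (M + c *: delta_mx w w) w j = cofactor M w j.
  congr (_ * \det _); apply/matrixP => i k; rewrite !mxE eq_sym (negbTE (neq_lift w i)).
  by rewrite mulr0 addr0.
rewrite (expand_det_row _ w) [\det M](expand_det_row _ w).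
under eq_bigr do rewrite cof !mxE eqxx mulrDl.
rewrite big_split /=; congr (_ + _).
rewrite (bigD1 w) //= eqxx mulr1 big1 ?addr0 // => j /negbTE ->.
by rewrite mulr0 mul0r.
Qed.

(** Adding an edge between w and a new vertex, weighted by a and b at its ends,
    is the rank-one update by the vector (- a e_w, b) of diag(M, y). The last
    row is split as b (- a e_w, b) + y (0, 1): a row operation makes the matrix
    with the first part block triangular, and the second reduces the determinant
    to that of M + a^2 E_ww. *)
Lemma det_leaf (R : comNzRingType) n (M : 'M[R]_n) (w : 'I_n) (a b y : R) :
  \det (block_mx (M + (a ^+ 2) *: delta_mx w w) (- (a * b) *: delta_mx w 0)
                 (- (a * b) *: delta_mx 0 w) (y + b ^+ 2)%:M : 'M_(n + 1))
   = (y + b ^+ 2) * \det M + a ^+ 2 * (y * cofactor M w w).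
Proof.
set N := M + _; set c := _ *: delta_mx w 0; set A := block_mx _ _ _ _.
pose B : 'M_(n + 1) := block_mx N c (- a *: delta_mx 0 w) b%:M.
pose C : 'M_(n + 1) := block_mx N c 0 1%:M.
have detC : \det C = \det N by rewrite det_ublock det1 mulr1.
have detB : \det B = \det M * b.
  have -> : B = block_mx 1%:M (- a *: delta_mx w 0) 0 1%:M
              *m block_mx M 0 (- a *: delta_mx 0 w) b%:M.
    rewrite mulmx_block !mul1mx !mul0mx !add0r /B; congr block_mx.
      rewrite -scalemxAl -scalemxAr scalerA mulrNN -expr2.
      by rewrite mul_delta_mx.
    rewrite /c mul_mx_scalar scalerA; congr (_ *: _); ring.
  by rewrite det_mulmx det_ublock det_lblock !det1 det_scalar1 !mul1r.
have row'E D r : row' (rshift n 0) (block_mx N c D r : 'M_(n + 1)) =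
    row' (rshift n 0) A.
  apply/matrixP => i j; rewrite !mxE.
  case: splitP => k Hk; rewrite ?mxE //.
  by have /eqP[] := neq_lift (rshift n 0) i; apply: ord_inj; rewrite Hk ord1.
rewrite (@determinant_multilinear _ _ A B C (rshift n 0) b y) ?row'E //.
  by rewrite detB detC det_add_delta; ring.
apply/rowP => j; rewrite !mxE; case: splitP => k /= Hk; first by have := ltn_ord k; lia.
rewrite ord1 {k Hk} !mxE; case: splitP => l _; rewrite !mxE ?ord1 /=; ring.
Qed.

(** The column of the incidence matrix for the edge l w, with the entries of
    grounded vertices replaced by 0. *)
Definition edge_vec (t : nat -> bool) (l w k : nat) : {poly int} :=
  (t l && (k == l))%:R - (t w && (k == w))%:R.

(** The entries of X + D_t L D_t, with L written as the sum over the edges of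
    the matrices b b^T for b the edge vector. *)
Fixpoint grounded_entry (p : seq nat) (t : nat -> bool) (i j : nat) : {poly int} :=
  if p is w :: p' then
    grounded_entry p' t i j + edge_vec t (size p) w i * edge_vec t (size p) w j
  else 'X *+ (i == j).

Lemma grounded_entryC p t i j : grounded_entry p t i j = grounded_entry p t j i.
Proof. by elim: p => [|w p IHp] /=; rewrite ?IHp 1?mulrC // eq_sym. Qed.

Lemma grounded_entry_out p t i j : valid_parents p -> (size p < j)%N ->
  grounded_entry p t i j = 'X *+ (i == j).
Proof.
elim: p => [|w p IHp] //= /andP[w_le vp] j_gt; rewrite IHp //; last by lia.
rewrite /edge_vec (gtn_eqF j_gt) [j == w]gtn_eqF; last by lia.
by rewrite !andbF subrr mulr0 addr0.
Qed.

Lemma grounded_entry_ground p t w i j : i != w -> j != w ->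
  grounded_entry p (ground w t) i j = grounded_entry p t i j.
Proof.
move=> iw jw; elim: p => [|v p IHp] //=; rewrite IHp.
have vecE l k : k != w -> edge_vec (ground w t) l v k = edge_vec t l v k.
  move=> kw; have groundE x : ground w t x && (k == x) = t x && (k == x).
    by rewrite /ground; case: (k =P x) => [<-|_]; rewrite ?kw ?andbT ?andbF.
  by rewrite /edge_vec !groundE.
by rewrite !vecE.
Qed.

Lemma grounded_entry_ground_row p t w j :
  grounded_entry p (ground w t) w j = 'X *+ (w == j).
Proof.
elim: p => [|v p IHp] //=; rewrite IHp.
have -> l : edge_vec (ground w t) l v w = 0.
  have groundE x : ground w t x && (w == x) = false.
    by rewrite /ground; case: (w =P x) => [<-|_]; rewrite ?eqxx ?andbF.
  by rewrite /edge_vec !groundE subrr.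
by rewrite mul0r addr0.
Qed.

(** The cofactor produced by the last leaf becomes, after multiplication by X,
    the determinant with w grounded: the row of w is then X e_w. *)
Lemma det_grounded p t n : valid_parents p -> n = (size p).+1 ->
  \det (\matrix_(i < n, j < n) grounded_entry p t i j) = grounded_poly p t.
Proof.
elim: p t n => [|w p IHp] t n; first by move=> _ ->; rewrite det_mx11 mxE.
move=> /andP[w_le vp] n_eq.
have {n_eq}-> : n = ((size p).+1 + 1)%N by rewrite n_eq /=; lia.
set m := (size p).+1; pose w' : 'I_m := Ordinal (w_le : (w < m)%N).
pose M := \matrix_(i < m, j < m) grounded_entry p t i j.
have vec_l : edge_vec t m w m = (t m)%:R.
  by rewrite /edge_vec eqxx andbT gtn_eqF ?andbF ?subr0.
have vec_lt (k : 'I_m) : edge_vec t m w k = - (t w)%:R * (k == w')%:R.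
  by rewrite /edge_vec ltn_eqF // andbF sub0r mulNr -natrM mulnb.
have -> : \matrix_(i < m + 1, j < m + 1) grounded_entry (w :: p) t i j
  = block_mx (M + ((t w)%:R ^+ 2) *: delta_mx w' w')
       (- ((t w)%:R * (t m)%:R) *: delta_mx w' 0)
       (- ((t w)%:R * (t m)%:R) *: delta_mx 0 w') ('X + (t m)%:R ^+ 2)%:M.
  apply/matrixP => i j; rewrite !mxE.
  case: splitP => i' Hi; rewrite !mxE; case: splitP => j' Hj; rewrite !mxE /= -/m Hi Hj
    ?(ord1 i') ?(ord1 j') ?addn0 ?vec_l ?vec_lt.
  - rewrite -mulnb natrM; ring.
  - by rewrite grounded_entry_out // ltn_eqF // mulr0n eqxx andbT; ring.
  - by rewrite grounded_entryC grounded_entry_out // ltn_eqF // mulr0n /=; ring.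
  - by rewrite grounded_entry_out // eqxx /= mulr1n expr2.
rewrite det_leaf grounded_poly_cons -/m IHp //.
have sqr_b (b : bool) : b%:R ^+ 2 = b%:R :> {poly int} by case: b; rewrite ?expr1n ?expr0n.
rewrite !sqr_b; congr (_ + _ * _).
rewrite -(IHp (ground w t) m) // (expand_det_row _ w') (bigD1 w') //= big1 ?addr0; last first.
  move=> j; rewrite mxE grounded_entry_ground_row eq_sym -val_eqE => /negbTE /= ->.
  by rewrite mulr0n mul0r.
rewrite mxE grounded_entry_ground_row eqxx mulr1n; congr (_ * (_ * \det _)).
apply/matrixP => i j; rewrite !mxE grounded_entry_ground //.
  by have := neq_lift w' i; rewrite -val_eqE eq_sym.
by have := neq_lift w' j; rewrite -val_eqE eq_sym.
Qed.

(** * Laplacian coefficients of a coded tree *)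

Section Coded.
Variables (V : finType) (G : sgraph V).

(** The enumeration e lists vertices of G so that each one after the first is
    adjacent to exactly one earlier vertex, its parent according to p. *)
Fixpoint codes (e : nat -> V) (p : seq nat) : Prop :=
  if p is w :: p' then
    [/\ (w <= size p')%N, codes e p' &
       forall i, (i <= size p')%N -> G (e i) (e (size p)) = (i == w)]
  else True.

Lemma codes_valid e p : codes e p -> valid_parents p.
Proof. by elim: p => //= w p IHp [-> /IHp]. Qed.

Lemma coded_entry e p i j : codes e p -> (i < j <= size p)%N ->
  grounded_entry p all_true i j = - (G (e i) (e j))%:R.
Proof.
elim: p => [|w p IHp] /=; first by lia.
move=> [w_le cp adj_l] /andP[ij]; rewrite leq_eqVlt => /predU1P[j_eq|j_lt].
  rewrite j_eq grounded_entry_out ?(codes_valid cp) // -j_eq ltn_eqF //.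
  rewrite j_eq adj_l; last by lia.
  rewrite /edge_vec eqxx -j_eq ltn_eqF //= [j == w]gtn_eqF; last by lia.
  by rewrite subr0 mulr1 sub0r add0r.
rewrite IHp ?ij // /edge_vec /= (ltn_eqF j_lt) (ltn_eqF (ltn_trans ij j_lt)).
have ijw : (i == w) && (j == w) = false by lia.
by rewrite !sub0r mulrNN -natrM mulnb ijw addr0.
Qed.

Lemma sum_delta (n k : nat) : (k < n)%N ->
  \sum_(j < n) (nat_of_ord j == k)%:R = 1 :> {poly int}.
Proof.
move=> k_lt; rewrite (bigD1 (Ordinal k_lt)) //= eqxx big1 ?addr0 // => j.
by rewrite -val_eqE /= => /negbTE ->.
Qed.

(** Edge vectors sum to 0. Together with row_sum_lap this determines the diagonal
    entries from the others, so that degrees never have to be computed from the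
    parent list. *)
Lemma row_sum_grounded p n i : valid_parents p -> (size p < n)%N -> (i < n)%N ->
  \sum_(j < n) grounded_entry p all_true i j = 'X.
Proof.
move=> + + i_lt; elim: p => [|w p IHp] /=.
  move=> _ _; under eq_bigr do rewrite eq_sym -mulr_natr.
  by rewrite -mulr_sumr sum_delta ?mulr1.
move=> /andP[w_le vp] p_lt; rewrite big_split /= IHp //; last by lia.
rewrite -mulr_sumr /edge_vec /= sumrB !sum_delta //; last by lia.
by rewrite subrr mulr0 addr0.
Qed.

(** The entries of X + L, indexed by vertices. *)
Definition lap_entry (u v : V) : {poly int} :=
  'X *+ (u == v) + ((degree G u)%:R *+ (u == v) - (G u v)%:R).

Lemma row_sum_lap u : \sum_v lap_entry u v = 'X.
Proof.
rewrite /lap_entry big_split /= sumrB.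
have sumd (c : {poly int}) : \sum_v c *+ (u == v) = c.
  rewrite (bigD1 u) //= eqxx big1 ?addr0 // => v; rewrite eq_sym => /negbTE ->.
  by rewrite mulr0n.
rewrite !sumd -natr_sum.
have -> : (\sum_v G u v)%N = degree G u.
  rewrite /degree -sum1_card [RHS]big_mkcond; apply: eq_bigr => v _.
  by rewrite inE; case: (G u v).
by rewrite subrr addr0.
Qed.

Lemma coef_compN (p : {poly int}) i : (p \Po - 'X)`_i = (-1) ^+ i * p`_i.
Proof.
elim/poly_ind: p i => [|p c IHp] i; first by rewrite comp_poly0 coef0 mulr0.
rewrite comp_poly_MXaddC mulrN !coefD coefN !coefMX !coefC.
case: i => [|i] /=; first by rewrite oppr0 !add0r mul1r.
by rewrite !addr0 IHp exprS mulN1r mulNr.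
Qed.

Lemma lap_coef_det k : (k <= #|V|)%N ->
  lap_coef G k =
    (\det (\matrix_(i < #|V|, j < #|V|)
       lap_entry (enum_val i) (enum_val j)))`_(#|V| - k).
Proof.
move=> k_le; rewrite /lap_coef; set P := \det _.
have compE : char_poly (laplacian G) \Po - 'X = (-1) ^+ #|V| * P.
  rewrite /char_poly -det_map_mx /P -detZ; congr (\det _).
  apply/matrixP => i j; rewrite !mxE rmorphB rmorphMn /= comp_polyX comp_polyC.
  rewrite /lap_entry (inj_eq enum_val_inj) polyCB polyCMn.
  by rewrite !polyC_natr mulN1r mulNrn -opprD.
have coefE : (-1) ^+ (#|V| - k) * (char_poly (laplacian G))`_(#|V| - k)
    = (-1) ^+ #|V| * P`_(#|V| - k).
  have signE : (-1) ^+ #|V| = ((-1) ^+ #|V|)%:P :> {poly int} by rewrite rmorphXn rmorphN1.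
  by rewrite -coef_compN compE signE coefCM.
have -> : (-1) ^+ k = (-1) ^+ #|V| * (-1) ^+ (#|V| - k) :> int.
  by rewrite -[in RHS](subnKC k_le) addKn exprD -mulrA -expr2 sqrr_sign mulr1.
by rewrite -mulrA coefE mulrA -expr2 sqrr_sign mul1r.
Qed.

(** Passing from the numbering of the vertices that defines the Laplacian to the
    enumeration e conjugates X + L by a permutation matrix. *)
Lemma lap_coef_coded e p k : codes e p -> #|V| = (size p).+1 ->
  {in gtn #|V| &, injective e} -> (k <= #|V|)%N ->
  lap_coef G k = (grounded_poly p all_true)`_(#|V| - k).
Proof.
move=> cp cardV e_inj k_le; rewrite lap_coef_det // -(det_grounded _ (codes_valid cp) cardV).
congr (_`_ _).
pose f (i : 'I_#|V|) := enum_rank (e i).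
have f_inj : injective f.
  by move=> i j /enum_rank_inj /e_inj ij; apply/val_inj/ij; exact: ltn_ord.
pose s := perm f_inj.
set A := \matrix_(i, j) lap_entry _ _; set B := \matrix_(i, j) _.
have sqr_sign1 : (-1) ^+ s * (-1) ^+ s^-1%g = 1 :> {poly int}.
  by rewrite odd_permV -expr2 sqrr_sign.
have <- : row_perm s (col_perm s A) = B; last first.
  by rewrite row_permE col_permE !det_mulmx !det_perm mulrCA sqr_sign1 mulr1.
have eK i : enum_val (s i) = e i by rewrite permE enum_rankK.
have off (i j : 'I_#|V|) : i != j -> lap_entry (e i) (e j) = B i j.
  move=> ij; rewrite mxE; wlog lt_ij : i j ij / (i < j)%N.
    move=> wl; case: (ltngtP i j) => [lt|lt|/val_inj eq_ij]; first exact: wl.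
      rewrite grounded_entryC -wl 1?eq_sym //.
      by rewrite /lap_entry eq_sym adj_sym; case: eqP => // ->.
    by rewrite eq_ij eqxx in ij.
  rewrite (coded_entry cp) ?lt_ij; last by rewrite -ltnS -cardV ltn_ord.
  have /negbTE eij : e i != e j.
    by apply: contra ij => /eqP/e_inj ij; apply/eqP/val_inj/ij; exact: ltn_ord.
  by rewrite /lap_entry eij !mulr0n !add0r.
apply/matrixP => i j; rewrite !mxE !eK.
have [<-{j}|] := eqVneq i j; last by move/off->; rewrite mxE.
have rowE : \sum_(j < #|V|) lap_entry (e i) (e j) = \sum_(j < #|V|) B i j.
  transitivity ('X : {poly int}).
    rewrite -(row_sum_lap (e i)) [RHS](reindex (fun j : 'I_#|V| => e j)) //.
    apply: onW_bij; apply: inj_card_bij; last by rewrite card_ord.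
    by move=> j l /e_inj jl; apply/val_inj/jl; exact: ltn_ord.
  symmetry; under eq_bigr do rewrite mxE.
  by rewrite row_sum_grounded ?(codes_valid cp) // cardV.
move: rowE; rewrite (bigD1 i) //= [RHS](bigD1 i) //=.
rewrite (eq_bigr (fun j => B i j)); last by move=> j; rewrite eq_sym; exact: off.
by move/addIr->; rewrite mxE.
Qed.

End Coded.

(** * Enumerating a tree from a diametral path *)

Section Growth.
Variables (V : finType) (G : sgraph V).

Lemma eq_codes (e e' : nat -> V) p : (forall i, (i <= size p)%N -> e i = e' i) ->
  codes G e p -> codes G e' p.
Proof.
elim: p => [|w p IHp] //= ee' [w_le cp adj_l]; split=> //.
  by apply: IHp cp => i i_le; apply: ee'; exact: leqW.
by move=> i i_le; rewrite -!ee' //; [exact: adj_l | exact: leqW].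
Qed.

(** Adjacency in the subgraph induced by s. *)
Definition inside (s : seq V) : rel V := [rel x y | [&& G x y, x \in s & y \in s]].

Definition connected_in (s : seq V) : Prop :=
  forall x y, x \in s -> y \in s -> connect (inside s) x y.

(** A path from w to w' inside s, closed up through z, would be a cycle. *)
Lemma acyclic_unique_neighbor s w w' z : acyclic_graph G -> connected_in s ->
  w \in s -> w' \in s -> z \notin s -> G w z -> G w' z -> w = w'.
Proof.
move=> acyc conn ws w's zs wz w'z; apply/eqP/negP => /negP ww'.
case/connectP: (conn _ _ ws w's) => c0 /shortenP[c pc uc _] last_c.
have c_in : {subset c <= s}.
  elim: c w {ws wz ww' uc last_c} pc => [|x c IHc] w //= /andP[/and3P[_ _ xs] pc] y.
  by rewrite inE => /predU1P[->|] //; exact: IHc pc y.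
apply: (acyc (z :: w :: c)).
  by case: c last_c {pc uc c_in} ww' => //= ->; rewrite eqxx.
have sub_inside : subrel (inside s) G by move=> x y /and3P[].
rewrite /ucycle /= rcons_path -last_c (sub_path sub_inside pc) w'z adj_sym wz /=.
move: uc => /= ->; rewrite andbT inE negb_or.
by rewrite (contra (@c_in z)) // andbT; apply: contra zs => /eqP ->.
Qed.

(** The vertices enumerated so far are connected among themselves, which is what
    forces the next vertex to have a single neighbour among them. *)
Record grown (x0 : V) (s : seq V) (p : seq nat) : Prop := Grown {
  grown_size : size s = (size p).+1;
  grown_uniq : uniq s;
  grown_conn : connected_in s;
  grown_codes : codes G (nth x0 s) p }.

Lemma grown1 x0 x : grown x0 [:: x] [::].
Proof. by split=> // y z; rewrite !inE => /eqP-> /eqP->. Qed.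

Lemma grown_rcons x0 s p w z : acyclic_graph G -> grown x0 s p ->
  w \in s -> z \notin s -> G w z -> grown x0 (rcons s z) (index w s :: p).
Proof.
move=> acyc [sz us conn cp] ws zs wz; split.
- by rewrite size_rcons sz.
- by rewrite rcons_uniq zs.
- have sub : subrel (inside s) (inside (rcons s z)).
    by move=> x y /and3P[xy xs ys]; rewrite /inside /= !mem_rcons !inE xy xs ys !orbT.
  have wz' : inside (rcons s z) w z.
    by rewrite /inside /= !mem_rcons !inE wz ws eqxx orbT.
  have zw' : inside (rcons s z) z w.
    by rewrite /inside /= !mem_rcons !inE adj_sym wz ws eqxx orbT.
  have subc x y : connect (inside s) x y -> connect (inside (rcons s z)) x y.
    by apply: connect_sub => a b /sub; exact: connect1.
  have to_w x : x \in rcons s z -> connect (inside (rcons s z)) x w.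
    rewrite mem_rcons inE => /predU1P[->|xs]; first exact: connect1.
    exact/subc/conn.
  have from_w x : x \in rcons s z -> connect (inside (rcons s z)) w x.
    rewrite mem_rcons inE => /predU1P[->|xs]; first exact: connect1.
    exact/subc/conn.
  by move=> x y /to_w xw /from_w; exact: connect_trans.
- have lt_idx : (index w s < size s)%N by rewrite index_mem.
  split=> [|| i i_le].
  + by rewrite -ltnS -sz.
  + apply: eq_codes cp => i i_le; rewrite nth_rcons sz ltnS i_le //.
  + rewrite !nth_rcons sz ltnS i_le /= ltnn eqxx.
    have i_lt : (i < size s)%N by rewrite sz.
    apply/idP/eqP => [adj_iz | ->]; last by rewrite nth_index.
    rewrite -(index_uniq x0 i_lt us); congr index.
    exact: (acyclic_unique_neighbor acyc conn (mem_nth _ i_lt) ws zs).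
Qed.

Lemma grown_path x0 x c : acyclic_graph G -> path G x c -> uniq (x :: c) ->
  grown x0 (x :: c) (path_parents (size c)).
Proof.
move=> acyc; elim/last_ind: c => [|c z IHc]; first by move=> *; exact: grown1.
rewrite rcons_path -rcons_cons rcons_uniq size_rcons path_parentsS.
move=> /andP[pc adj_z] /andP[z_out uc].
have {1}<- : index (last x c) (x :: c) = size c by rewrite index_last.
by apply: grown_rcons => //; [exact: IHc | exact: mem_last].
Qed.

(** While some vertex is missing, a walk from a listed vertex to it leaves the
    list along an edge, whose far end can be listed next. *)
Lemma grown_extend x0 s p : is_tree G -> grown x0 s p ->
  exists q s', grown x0 s' (q ++ p) /\ size s' = #|V|.
Proof.
move=> [conn acyc]; have [m] := ubnP (#|V| - size s).
elim: m s p => // m IHm s p m_gt gr.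
have le_s : (size s <= #|V|)%N by rewrite -(card_uniqP (grown_uniq gr)) max_card.
move: le_s; rewrite leq_eqVlt => /predU1P[s_eq|s_lt]; first by exists [::], s.
have [w [z [ws zs wz]]] : exists w z, [/\ w \in s, z \notin s & G w z].
  have [z zs] : exists z, z \notin s.
    apply/existsP; rewrite -negb_forall; apply/negP => /forallP all_s.
    move: s_lt; rewrite ltnNge => /negP; apply.
    by rewrite -(card_uniqP (grown_uniq gr)) subset_leq_card //; apply/subsetP.
  have hs : head z s \in s.
    by move: (grown_size gr); case: (s) => //= x t _; rewrite mem_head.
  case/connectP: (conn (head z s) z) => c; elim: c (head z s) hs => [|y c IHc] x xs /=.
    by move=> _ zx; rewrite zx xs in zs.
  move=> /andP[xy pc] last_c; have [ys|ys] := boolP (y \in s).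
    exact: IHc ys pc last_c.
  by exists x, y.
have [||q [s' [gr' sz']]] := IHm (rcons s z) (index w s :: p).
- by rewrite size_rcons; lia.
- exact: grown_rcons.
by exists (rcons q (index w s)), s'; rewrite cat_rcons.
Qed.

(** A walk of minimal length between two vertices at distance d, once shortened
    to be simple, still has length d. *)
Lemma diametral_path d : is_tree G -> (0 < #|V|)%N -> diameter G = d ->
  exists x c, [/\ path G x c, uniq (x :: c) & size c = d].
Proof.
move=> [conn _] V0 <-; rewrite /diameter.
have [x ->] := @bigop.eq_bigmax _ (fun u => \max_v gdist G u v)%N V0.
have [y ->] := @bigop.eq_bigmax _ (gdist G x) V0.
have [c0 [pc0 last_c0 sz_c0]] := gdist_attained (conn x y).
move: last_c0 sz_c0; case/shortenP: pc0 => c pc uc sub last_c sz_c0.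
exists x, c; split=> //; apply/eqP; rewrite eqn_leq gdist_min // andbT -sz_c0.
by apply: uniq_leq_size; [case/andP: uc | exact: sub].
Qed.

End Growth.

(** * The caterpillar with all leaves at the centre *)

Lemma codes_broom (V : finType) (G : sgraph V) (e : nat -> V) (d m r : nat) :
  (m <= d)%N ->
  (forall i j, (i < j <= d)%N -> G (e i) (e j) = (i.+1 == j)) ->
  (forall i j, (i < j)%N -> (d < j <= r + d)%N -> G (e i) (e j) = (i == m)) ->
  codes G e (nseq r m ++ path_parents d).
Proof.
move=> m_le spine; elim: r => [|r IHr] leaves.
  have: (d <= d)%N by []; rewrite [nseq 0 m ++ _]/=.
  elim: {-2}d => // d' IHd' d'_lt; rewrite path_parentsS /= size_path_parents.
  split=> //; first exact: IHd' (ltnW d'_lt).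
  by move=> i i_le; rewrite spine ?eqSS ?ltnS ?i_le.
rewrite /= size_cat size_nseq size_path_parents; split.
- by rewrite (leq_trans m_le) ?leq_addl.
- by apply: IHr => i j ij j_le; apply: leaves => //; lia.
- by move=> i i_le; apply: leaves; lia.
Qed.

(** List the path vertices in order and then all the leaves. A leaf with tag i
    exists only if i + 1 = d/2, as the other vertices carry no leaf. *)
Lemma codes_Cnd n d x0 : (2 <= d <= n - 1)%N ->
  exists s, [/\ uniq s, size s = n &
    codes (Cnd n d) (nth x0 s) (nseq (n - d.+1) d./2 ++ path_parents d)].
Proof.
move=> hd; pose a := Cnd_seq n d.
pose spine : seq (cat_vertex d a) := map inl (enum 'I_d.+1).
pose leaves : seq (cat_vertex d a) := map inr (enum {: {i : 'I_d.-1 & 'I_(a i.+1)}}).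
have sz_spine : size spine = d.+1 by rewrite size_map size_enum_ord.
have sz_s : size (spine ++ leaves) = n.
  rewrite -[RHS](card_Cnd hd) card_sum card_ord size_cat sz_spine size_map.
  by rewrite -cardE.
exists (spine ++ leaves); split=> //.
  have inl_inj : injective (@inl 'I_d.+1 {i : 'I_d.-1 & 'I_(a i.+1)}) by move=> u v [].
  have inr_inj : injective (@inr 'I_d.+1 {i : 'I_d.-1 & 'I_(a i.+1)}) by move=> u v [].
  rewrite cat_uniq (map_inj_uniq inl_inj) (map_inj_uniq inr_inj) !enum_uniq.
  by rewrite andbT; apply/hasPn => u /mapP[l _ ->]; apply/mapP => -[].
have spineE i : (i <= d)%N -> nth x0 (spine ++ leaves) i = inl (inord i).
  move=> i_le; rewrite nth_cat sz_spine ltnS i_le.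
  rewrite (nth_map ord0) ?size_enum_ord //; congr inl.
  by apply: ord_inj; rewrite nth_enum_ord // inordK.
have leafE i : (d < i < n)%N -> exists l, nth x0 (spine ++ leaves) i = inr l.
  move=> /andP[i_gt i_lt]; have: nth x0 (spine ++ leaves) i \in leaves.
    rewrite nth_cat sz_spine ltnNge i_gt mem_nth // -(ltn_add2l (size spine)).
    by rewrite -size_cat sz_s sz_spine subnKC.
  by case/mapP => l _ ->; exists l.
have tagE (l : {i : 'I_d.-1 & 'I_(a i.+1)}) : (tag l).+1 = d./2.
  case: l => i [j]; rewrite /a /Cnd_seq /=; by case: eqP.
apply: codes_broom; first by lia.
  move=> i j /andP[ij j_le]; rewrite !spineE //; last by lia.
  by rewrite /= !inordK; lia.
move=> i j ij j_le; have [|l ->] := leafE j; first by lia.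
have [i_gt|i_le] := ltnP d i; last by rewrite spineE //= inordK // tagE.
have [|l' ->] := leafE i; first by lia.
rewrite /=; lia.
Qed.

Theorem theorem11 (n d : nat) (hd : (2 <= d <= n - 1)%N)
    (V : finType) (T : sgraph V)
    (hn : #|V| = n) (hT : is_tree T) (hdiam : diameter T = d)
    (k : nat) (hk : (k <= n)%N) :
  lap_coef (Cnd n d) k <= lap_coef T k.
Proof.
have nth_inj (W : finType) (x0 : W) s : uniq s -> size s = #|W| ->
    {in gtn #|W| &, injective (nth x0 s)}.
  by move=> us sz i j i_lt j_lt; move/eqP; rewrite nth_uniq ?sz // => /eqP.
have V0 : (0 < #|V|)%N by lia.
have [x [c [pc uc sz_c]]] := diametral_path hT V0 hdiam.
have gr := grown_path x (proj2 hT) pc uc; rewrite sz_c in gr.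
have [q [s [[sz us _ cs] szV]]] := grown_extend hT gr.
have [s' [us' sz' cs']] := @codes_Cnd n d (inl ord0) hd.
have sz_q : size q = (n - d.+1)%N.
  by move: sz; rewrite szV hn size_cat size_path_parents; lia.
rewrite (lap_coef_coded cs (_ : _ = _) (nth_inj _ _ _ us szV)) ?hn //; last first.
  by rewrite -hn -szV sz.
rewrite (lap_coef_coded cs' _ (nth_inj _ _ _ us' _)) ?card_Cnd //; last first.
  by rewrite size_cat size_nseq size_path_parents; lia.
by apply: le_coefP; rewrite -sz_q; apply: le_grounded_broom; exact: codes_valid cs.
Qed.
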